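(* Let $T$ be a triangulation of the convex $(n+2)$-gon $\mathsf{P}_{n+2}$ and let $\mathbf{v}_k,\mathbf{w}_k$ ($k\in[n]$) be the vectors associated with $T$. Define a set $\Sigma_T$ of cones as follows: a subset $Q\subset\{\mathbf{v}_k,\mathbf{w}_k\mid k\in[n]\}$ forms a cone $\operatorname{Cone}(Q)\in\Sigma_T$ if and only if $\{\mathbf{v}_i,\mathbf{w}_i\}\not\subset Q$ for all $i\in[n]$. Then $\Sigma_T$ is a complete non-singular fan in $N\otimes\mathbb{R}$. Moreover, the set of primitive collections of $\Sigma_T$ is $\operatorname{PC}(\Sigma_T)=\{\{\mathbf{v}_k,\mathbf{w}_k\}\mid k\in[n]\}$.
   Context: Here $n\ge1$ and $[n]=\{1,\dots,n\}$. Let $\mathsf{P}_{n+2}$ be a convex $(n+2)$-gon with vertices labelled $0,1,\dots,n+1$ in counterclockwise order. A triangulation $T$ of $\mathsf{P}_{n+2}$ is a decomposition into $n$ triangles by $n-1$ diagonals not crossing in their interiors; $T$ is also regarded as the set of all edges of these triangles (sides and chosen diagonals). Put $e=\{0,n+1\}$, the distinguished edge. Define $F\colon T\setminus\{e\}\to\{\mathsf{L},\mathsf{R}\}$ recursively: for a triangulated polygon with distinguished edge $g$ (starting with $\mathsf{P}_{n+2}$ and $g=e$), the unique triangle containing $g$ has two other edges $f_{\mathsf{L}}(g),f_{\mathsf{R}}(g)$, named so that $f_{\mathsf{L}}(g),f_{\mathsf{R}}(g),g$ are placed counterclockwise; set $F(f_{\mathsf{L}}(g))=\mathsf{L}$,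 $F(f_{\mathsf{R}}(g))=\mathsf{R}$. Removing $g$ leaves two triangulated polygons (possibly single edges) with one common vertex and with distinguished edges $f_{\mathsf{L}}(g)$ and $f_{\mathsf{R}}(g)$; repeat for each of them that is not a single edge. The left tree $\mathcal{T}_T^{\mathsf{L}}$ has vertex set $\{0,\dots,n\}$, root $0$ and edge set $F^{-1}(\mathsf{L})$; the right tree $\mathcal{T}_T^{\mathsf{R}}$ has vertex set $\{1,\dots,n+1\}$, root $n+1$ and edge set $F^{-1}(\mathsf{R})$. For each $1\le k\le n$ there is exactly one edge $\{k_{\mathsf{L}},k\}$ of $\mathcal{T}_T^{\mathsf{L}}$ with $k_{\mathsf{L}}<k$ and exactly one edge $\{k,k_{\mathsf{R}}\}$ of $\mathcal{T}_T^{\mathsf{R}}$ with $k<k_{\mathsf{R}}$; this defines $k_{\mathsf{L}},k_{\mathsf{R}}$. Let $N=\mathbb{Z}^{n+1}/\mathbb{Z}(1,\dots,1)$ and let $\varpi_i\in N$ be the image of $\sum_{k=1}^i e_k$ ($0\le i\le n+1$), so $\varpi_0=\varpi_{n+1}=0$. The vectors associated with $T$ are $\mathbf{v}_k=\varpi_k-\varpi_{k_{\mathsf{R}}}$ and $\mathbf{w}_k=\varpi_{k_{\mathsf{L}}}-\varpi_k$ for $k\in[n]$. For a fan $\Sigma$, a subset $P$ of the primitive ray vectors of $\Sigma$ is a primitive collection if $\operatorname{Cone}(P)\notin\Sigma$ but $\operatorname{Cone}(P\setminus\{\mathbf{u}\})\in\Sigma$ for every $\mathbf{u}\in P$; $\operatorname{PC}(\Sigma)$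 is the set of primitive collections. Non-singular means every cone is generated by part of a $\mathbb{Z}$-basis of $N$. *)

(* Defs.v *)
From HB Require Import structures.
From mathcomp Require Import all_boot all_order all_algebra.
From mathcomp Require Import generic_quotient ring_quotient.
From mathcomp Require Import boolp classical_sets functions cardinality reals.

Set Implicit Arguments.
Unset Strict Implicit.
Unset Printing Implicit Defensive.

Import Order.TTheory GRing.Theory Num.Theory.

Local Open Scope classical_set_scope.
Local Open Scope ring_scope.

(* The vertices 0, ..., n+1 of the polygon are the elements of 'I_n.+2; the   *)
(* segment {a, b} is encoded by the pair (a, b) with a < b.                   *)
Definition edge (n : nat) : finType := ('I_n.+2 * 'I_n.+2)%type.

Definition is_segment n (f : edge n) : bool := (f.1 < f.2)%N.

Definition is_side n (f : edge n) : bool :=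
  (f.2 == f.1.+1 :> nat) || ((f.1 == ord0) && (f.2 == ord_max)).

Definition is_diagonal n (f : edge n) : bool := is_segment f && ~~ is_side f.

(* Two chords of a convex polygon meet in their interiors iff their endpoints *)
(* strictly interlace.                                                        *)
Definition crossing n (f g : edge n) : bool :=
  [&& f.1 < g.1, g.1 < f.2 & f.2 < g.2]%N ||
  [&& g.1 < f.1, f.1 < g.2 & g.2 < f.2]%N.

(* T is the set of all sides together with the chosen n-1 diagonals; being    *)
(* pairwise non-crossing, these cut the polygon into n pieces, all triangles. *)
Definition is_triangulation n (T : {set edge n}) : Prop :=
  [/\ forall f, f \in T -> is_segment f,
      forall f, is_segment f -> is_side f -> f \in T,
      forall f g, f \in T -> g \in T -> ~~ crossing f g
    & #|[pred f in T | is_diagonal f]| = n.-1].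

Definition is_triangle n (T : {set edge n}) (a b c : 'I_n.+2) : Prop :=
  [/\ (a < b < c)%N, (a, b) \in T, (b, c) \in T & (a, c) \in T].

(* The distinguished edges g met in the recursive construction of F.  When    *)
(* g = (a, b), the polygon it bounds has vertices a, a+1, ..., b, so its      *)
(* triangle containing g is a, c, b with a < c < b.  As 0, ..., n+1 is the    *)
(* counterclockwise order, the edges {a, c}, {c, b}, g are placed             *)
(* counterclockwise: f_L(g) = (a, c) and f_R(g) = (c, b).                     *)
Inductive distinguished n (T : {set edge n}) : edge n -> Prop :=
| dist_root : distinguished T (ord0, ord_max)
| dist_left a c b : distinguished T (a, b) -> is_triangle T a c b ->
    distinguished T (a, c)
| dist_right a c b : distinguished T (a, b) -> is_triangle T a c b ->
    distinguished T (c, b).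

Inductive label := LabelL | LabelR.

(* The graph of F: edge_label T f l means F(f) = l. *)
Inductive edge_label n (T : {set edge n}) : edge n -> label -> Prop :=
| label_left a c b : distinguished T (a, b) -> is_triangle T a c b ->
    edge_label T (a, c) LabelL
| label_right a c b : distinguished T (a, b) -> is_triangle T a c b ->
    edge_label T (c, b) LabelR.

Definition left_tree n (T : {set edge n}) : set (edge n) :=
  [set f | edge_label T f LabelL].

Definition right_tree n (T : {set edge n}) : set (edge n) :=
  [set f | edge_label T f LabelR].

(* For a triangulation T and 1 <= k <= n the sets below are singletons; the   *)
(* default values ord0, ord_max are then never used.                          *)
Definition kL n (T : {set edge n}) (k : 'I_n.+2) : 'I_n.+2 :=
  xget ord0 [set j : 'I_n.+2 | (j < k)%N /\ left_tree T (j, k)].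

Definition kR n (T : {set edge n}) (k : 'I_n.+2) : 'I_n.+2 :=
  xget ord_max [set j : 'I_n.+2 | (k < j)%N /\ right_tree T (k, j)].

(* [n] = {1, ..., n}, inside the vertex set {0, ..., n+1} *)
Definition brack n : set 'I_n.+2 := [set k | (1 <= k <= n)%N].

(* K^(n+1) / K(1, ..., 1), used both for K = int and for K = R: diag_line is the line K(1, ..., 1). *)
Definition diag_line (K : comNzRingType) n : {pred 'rV[K]_n.+1} :=
  fun x => x == const_mx (x 0 0).
Arguments diag_line : clear implicits.

Lemma diag_lineP (K : comNzRingType) n (x : 'rV[K]_n.+1) :
  reflect (exists a, x = const_mx a) (x \in diag_line K n).
Proof.
apply: (iffP eqP) => [->|[a ->]]; first by exists (x 0 0).
by rewrite mxE.
Qed.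

Lemma diag_line_submod_closed (K : comNzRingType) n :
  subsemimod_closed (diag_line K n).
Proof.
split; first split.
- by apply/diag_lineP; exists 0; apply/matrixP => i j; rewrite !mxE.
- move=> x y /diag_lineP[a ->] /diag_lineP[b ->]; apply/diag_lineP.
  by exists (a + b); apply/matrixP => i j; rewrite !mxE.
- move=> a x /diag_lineP[b ->]; apply/diag_lineP.
  by exists (a * b); apply/matrixP => i j; rewrite !mxE.
Qed.

HB.instance Definition _ (K : comNzRingType) n :=
  GRing.isSubmodClosed.Build K 'rV[K]_n.+1 (diag_line K n)
    (diag_line_submod_closed K n).

Definition quot_diag (K : comNzRingType) n : Type :=
  Quotient.quot (diag_line K n).
Arguments quot_diag : clear implicits.

Section QuotDiagLmodule.
Variables (K : comNzRingType) (n : nat).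
Local Open Scope quotient_scope.

HB.instance Definition _ := EqQuotient.on (quot_diag K n).
HB.instance Definition _ := GRing.Zmodule.on (quot_diag K n).

Definition proj_diag (x : 'rV[K]_n.+1) : quot_diag K n := \pi x.

Lemma proj_diagP (x y : 'rV[K]_n.+1) :
  reflect (proj_diag x = proj_diag y) (x - y \in diag_line K n).
Proof. by rewrite [_ \in _]Quotient.idealrBE; apply: eqP. Qed.

Lemma proj_diag_surj (q : quot_diag K n) : exists x, q = proj_diag x.
Proof. by exists (repr q); rewrite /proj_diag reprK. Qed.

Lemma proj_diagB : zmod_morphism proj_diag.
Proof. exact: (@raddfB _ (Quotient.quot (diag_line K n)) \pi). Qed.

HB.instance Definition _ := GRing.isZmodMorphism.Build 'rV[K]_n.+1
  (quot_diag K n) proj_diag proj_diagB.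

Definition quot_diag_scale (a : K) (q : quot_diag K n) : quot_diag K n :=
  proj_diag (a *: repr q).

Lemma quot_diag_scaleE a x :
  quot_diag_scale a (proj_diag x) = proj_diag (a *: x).
Proof.
apply/proj_diagP; rewrite -scalerBr rpredZ //.
by apply/proj_diagP; rewrite /proj_diag reprK.
Qed.

Lemma quot_diag_scalerA a b q :
  quot_diag_scale a (quot_diag_scale b q) = quot_diag_scale (a * b) q.
Proof.
by case: (proj_diag_surj q) => x ->; rewrite !quot_diag_scaleE scalerA.
Qed.

Lemma quot_diag_scale1r : left_id 1 quot_diag_scale.
Proof.
by move=> q; case: (proj_diag_surj q) => x ->; rewrite quot_diag_scaleE scale1r.
Qed.

Lemma quot_diag_scalerDr : right_distributive quot_diag_scale +%R.
Proof.
move=> a q r; case: (proj_diag_surj q) (proj_diag_surj r) => x -> [y ->].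
by rewrite -raddfD !quot_diag_scaleE scalerDr raddfD.
Qed.

Lemma quot_diag_scalerDl q : {morph quot_diag_scale^~ q : a b / a + b}.
Proof.
move=> a b; case: (proj_diag_surj q) => x ->.
by rewrite !quot_diag_scaleE scalerDl raddfD.
Qed.

HB.instance Definition _ := GRing.Zmodule_isLmodule.Build K (quot_diag K n)
  quot_diag_scalerA quot_diag_scale1r quot_diag_scalerDr quot_diag_scalerDl.

Lemma proj_diagZ a x : proj_diag (a *: x) = a *: proj_diag x.
Proof. by rewrite -quot_diag_scaleE. Qed.

HB.instance Definition _ := GRing.isScalable.Build K 'rV[K]_n.+1
  (quot_diag K n) *:%R proj_diag proj_diagZ.

End QuotDiagLmodule.

Definition lattice (n : nat) := quot_diag int n.

(* N (x) R for N = Z^(n+1) / Z(1, ..., 1): by right exactness of the tensor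
   product it is R^(n+1) / R(1, ..., 1), and lattice_incl is x |-> x (x) 1. *)
Definition realspace (R : realType) (n : nat) := quot_diag R n.

HB.instance Definition _ n := GRing.Zmodule.on (lattice n).
HB.instance Definition _ (R : realType) n := GRing.Lmodule.on (realspace R n).

Definition lattice_incl (R : realType) n (x : lattice n) : realspace R n :=
  proj_diag (map_mx intr (repr x)).

Lemma lattice_inclE (R : realType) n (x : 'rV[int]_n.+1) :
  lattice_incl R (proj_diag x) = proj_diag (map_mx intr x).
Proof.
apply/proj_diagP; rewrite -raddfB.
have /proj_diagP/diag_lineP[a ->] :
  proj_diag (repr (proj_diag x)) = proj_diag x by rewrite /proj_diag reprK.
by apply/diag_lineP; exists a%:~R; apply/matrixP => i j; rewrite !mxE.
Qed.

Lemma lattice_inclB (R : realType) n : zmod_morphism (@lattice_incl R n).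
Proof.
move=> u v; case: (proj_diag_surj u) (proj_diag_surj v) => x -> [y ->].
by rewrite -raddfB !lattice_inclE raddfB raddfB.
Qed.

HB.instance Definition _ (R : realType) n :=
  GRing.isZmodMorphism.Build (lattice n) (realspace R n) (@lattice_incl R n)
    (@lattice_inclB R n).

(* varpi i is the image of e_1 + ... + e_i; delta_mx 0 k is e_(k+1). *)
Definition varpi n (i : 'I_n.+2) : lattice n :=
  proj_diag (\sum_(k < n.+1 | (k < i)%N) delta_mx 0 k).

Definition Cone (R : realType) (V : lmodType R) (S : set V) : set V :=
  [set x | exists m (u : 'I_m -> V) (c : 'I_m -> R),
     [/\ forall i, S (u i), forall i, 0 <= c i & x = \sum_i c i *: u i]].

Section Fans.
Variables (R : realType) (n : nat).
Local Notation N := (lattice n).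
Local Notation NR := (realspace R n).
Implicit Types (sigma tau : set NR) (Sigma : set (set NR)) (P : set N).

Definition lcone P : set NR := Cone (@lattice_incl R n @` P).

Definition rational_polyhedral sigma : Prop :=
  exists P, finite_set P /\ sigma = lcone P.

Definition strongly_convex sigma : Prop :=
  forall x, sigma x -> sigma (- x) -> x = 0.

(* m = 0 is allowed, so sigma is a face of itself. *)
Definition is_face tau sigma : Prop :=
  exists m : {scalar NR},
    (forall x, sigma x -> 0 <= m x) /\ tau = sigma `&` [set x | m x = 0].

Definition is_fan Sigma : Prop :=
  [/\ finite_set Sigma,
      forall sigma, Sigma sigma ->
        rational_polyhedral sigma /\ strongly_convex sigma,
      forall sigma tau, Sigma sigma -> is_face tau sigma -> Sigma tau
    & forall sigma tau, Sigma sigma -> Sigma tau ->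
        is_face (sigma `&` tau) sigma /\ is_face (sigma `&` tau) tau].

Definition is_complete Sigma : Prop :=
  forall x, exists2 sigma, Sigma sigma & sigma x.

Definition is_Zbasis r (b : 'I_r -> N) : Prop :=
  forall x, exists! c : {ffun 'I_r -> int}, x = \sum_i b i *~ c i.

Definition is_nonsingular Sigma : Prop :=
  forall sigma, Sigma sigma ->
    exists r (b : 'I_r -> N) (J : set 'I_r),
      is_Zbasis b /\ sigma = lcone (b @` J).

Definition is_primitive (u : N) : Prop :=
  u != 0 /\ forall (m : nat) (u' : N), u = u' *+ m -> m = 1%N.

(* A one-dimensional strongly convex rational cone is Cone({u}) for exactly
   one primitive u. *)
Definition ray_vectors Sigma : set N :=
  [set u | is_primitive u /\ Sigma (lcone [set u])].

Definition primitive_collections Sigma : set (set N) :=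
  [set P | [/\ P `<=` ray_vectors Sigma, ~ Sigma (lcone P)
             & forall u, P u -> Sigma (lcone (P `\ u))]].

End Fans.

Arguments lcone R {n} P.

Definition vvec n (T : {set edge n}) (k : 'I_n.+2) : lattice n :=
  varpi k - varpi (kR T k).

Definition wvec n (T : {set edge n}) (k : 'I_n.+2) : lattice n :=
  varpi (kL T k) - varpi k.

Definition vw_vectors n (T : {set edge n}) : set (lattice n) :=
  vvec T @` @brack n `|` wvec T @` @brack n.

Definition forms_cone n (T : {set edge n}) (Q : set (lattice n)) : Prop :=
  forall i, brack i -> ~ ([set vvec T i; wvec T i] `<=` Q).

(* Only the cones of the subsets Q with forms_cone T Q are put in; that no
   other Q has its cone there is part of what is to be proved. *)
Definition SigmaT (R : realType) n (T : {set edge n}) :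
    set (set (realspace R n)) :=
  [set lcone R Q | Q in [set Q | Q `<=` vw_vectors T /\ forms_cone T Q]].

Arguments SigmaT R {n} T.

(* Main.v *)
(* For every k in [n] the triangle of T with middle vertex k is (k_L, k, k_R), *)
(* so v_k and w_k are the vectors varpi_a - varpi_b of its two short edges     *)
(* {a, b}.  Since -(varpi_a - varpi_b) = e_(a+1) + ... + e_b, the coordinate   *)
(* -x_i of x = sum_k (c_k v_k + d_k w_k) is the sum of the coefficients of the *)
(* edges covering the side {i-1, i}.  If c, d >= 0 and c_k d_k = 0 for all k,  *)
(* then the sum of the coefficients of the edges covering a given edge {a, b}  *)
(* is, up to a common constant, the minimum of -x_i over a < i <= b; this      *)
(* gives existence and uniqueness of such an expression of x, hence            *)
(* completeness and the intersections of cones.  Descending from the root      *)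
(* edge, any choice of one of v_k, w_k for every k spans N over Z, because two *)
(* edge vectors of a triangle determine the third.                             *)

From HB Require Import structures.
Require Import Defs.
From mathcomp Require Import all_boot all_order all_algebra.
From mathcomp Require Import boolp classical_sets functions cardinality reals.
From mathcomp Require Import zify lra.

Set Implicit Arguments.
Unset Strict Implicit.
Unset Printing Implicit Defensive.

Import Order.TTheory GRing.Theory Num.Theory.

Local Open Scope classical_set_scope.
Local Open Scope ring_scope.

(** * Triangles of a triangulation *)

(** The argument has a formal half and a combinatorial half. In the formal half ([SplitFan]) the
    generators come in pairs indexed by ['I_r * bool]. Three facts are assumed: one generator from
    each pair spans the lattice over the integers, and every real vector has one, and only one,
    nonnegative expression using at most one generator of each pair. The coefficients of that
    expression, [coord], turn membership in a cone into a condition on supports ([mem_lcone]).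
    Faces, intersections, completeness, lattice bases and primitive collections are then read off
    from supports.

    The combinatorial half proves the three facts for [T]: [apex_Zspan], [apex_exists] and
    [apex_unique]. Each moves through the triangles of the recursion, the last two by
    [cover_sum_left] and [cover_sum_right]. The recursion never gets stuck because every polygon it
    reaches contains the maximal number of chords ([distinguished_full]), and it meets exactly one
    triangle with middle vertex [k] ([brack_triangle], [triangle_unique]). *)

Section Triangulation.
Variables (n : nat) (T : {set edge n}).
Hypothesis hT : is_triangulation T.

Implicit Types (a b c k : 'I_n.+2) (f g : edge n).

Let T_segment f : f \in T -> (f.1 < f.2)%N.
Proof. by case: hT => + _ _ _; apply. Qed.

Let T_side a b : b = a.+1 :> nat -> (a, b) \in T.
Proof.
move=> ab; case: hT => _ + _ _; apply; rewrite /is_segment /is_side /=; first lia.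
by rewrite ab eqxx.
Qed.

Lemma noncrossing a b c d : (a, b) \in T -> (c, d) \in T ->
  ~ [/\ a < c, c < b & b < d]%N.
Proof.
move=> ab cd [h1 h2 h3]; case: hT => _ _ /(_ _ _ ab cd) + _.
by rewrite /crossing /= h1 h2 h3.
Qed.

(** * Counting chords to produce triangles *)

Definition chords a b : {set edge n} :=
  [set f in T | [&& a <= f.1, f.2 <= b & f.1.+1 < f.2]%N].

Definition separates c a b : Prop := forall f, f \in T ->
  (a <= f.1)%N -> (f.2 <= b)%N -> f != (a, b) -> (f.2 <= c)%N \/ (c <= f.1)%N.

Lemma card_chords_split a c b : separates c a b ->
  (#|chords a b| <= ((a, b) \in T) + #|chords a c| + #|chords c b|)%N.
Proof.
move=> sep.
have sub : chords a b \subset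
    ((if (a, b) \in T then finset.set1 (a, b) else finset.set0) :|: chords a c) :|: chords c b.
  apply/fintype.subsetP => f; rewrite !finset.inE => /andP[fT /and3P[af fb ff]].
  have [fE|fN] := eqVneq f (a, b); first by rewrite -fE fT finset.inE eqxx.
  by case: (sep f fT af fb fN) => h; rewrite fT ff ?af ?fb ?h ?orbT.
apply: leq_trans (subset_leq_card sub) _.
apply: leq_trans (finset.leq_card_setU _ _) _; rewrite leq_add2r.
apply: leq_trans (finset.leq_card_setU _ _) _; rewrite leq_add2r.
by case: ifP; rewrite ?finset.cards1 ?finset.cards0.
Qed.

(* The farthest neighbour [c < b] of [a] cuts the polygon [a, ..., b]. *)
Lemma separating_vertex a b : (a.+1 < b)%N ->
  exists c, [/\ (a < c < b)%N, (a, c) \in T & separates c a b].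
Proof.
move=> ab.
have a1 : (a.+1 < n.+2)%N by apply: ltn_trans ab _.
pose P c := ((a, c) \in T) && (c < b)%N.
have P1 : P (Ordinal a1) by rewrite /P T_side.
case: (arg_maxnP (fun c : 'I_n.+2 => val c) P1) => c /andP[acT cb] cmax.
exists c; split=> //; first by rewrite cb (T_segment acT).
move=> [x y] xyT /= ax yb xyN.
have xy := T_segment xyT; rewrite /= in xy.
have [|cy] := leqP y c; [by left|have [|xc] := leqP c x; [by right|exfalso]].
have [xa|xa] := eqVneq (x : nat) a.
  have {}xa := val_inj xa; subst x.
  have [yb'|yb'] := eqVneq (y : nat) b.
    by rewrite (val_inj yb') eqxx in xyN.
  have := cmax y; rewrite /P xyT => /(_ _); rewrite /=; lia.
by apply: (noncrossing acT xyT); split=> //; lia.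
Qed.

(** Cutting at a separating vertex [c] matches [b - a - 1 = 1 + (c - a - 1) + (b - c - 1)], where
    the 1 accounts for the chord [(a, b)] itself. *)
Lemma card_chords_le a b : (a < b)%N -> (#|chords a b| <= (b - a).-1)%N.
Proof.
have [m] := ubnP (b - a)%N; elim: m a b => // m IH a b hm ab.
have [ab1|ab1] := ltnP a.+1 b; last first.
  have -> : (b - a).-1 = 0%N by lia.
  rewrite leqn0 finset.cards_eq0; apply/eqP/finset.setP => f; rewrite !finset.inE.
  by apply/negP => /andP[_ /and3P[]]; lia.
have [c [/andP[ac cb] acT sep]] := separating_vertex ab1.
have := card_chords_split sep; have := IH a c; have := IH c b.
by case: (_ \in T) => /=; lia.
Qed.

(* The equality case of [card_chords_le], inherited by both parts of a cut. *)
Definition full a b : Prop := #|chords a b| = (b - a).-1.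

Lemma full_root : full ord0 ord_max.
Proof.
case: hT => _ sideT _ cardT.
rewrite /full (finset.cardsD1 (ord0, ord_max)) finset.inE /=.
have -> : #|chords ord0 ord_max :\ (ord0, ord_max)| = n.-1.
  rewrite -cardT; apply: eq_card => -[x y]; rewrite !finset.inE /=.
  rewrite /is_diagonal /is_segment /is_side /= xpair_eqE -!val_eqE /=.
  have := ltn_ord y; case: (_ \in T) => /=; lia.
(* For [n = 0] the root edge has length 1 and is not counted as a chord; otherwise it adds 1 to the
   [n.-1] diagonals. *)
case: n T sideT => [|n'] T' sideT' /=; first by rewrite andbF; lia.
have -> : (ord0, ord_max) \in T'; last by lia.
by apply: sideT'; rewrite /is_side /= ?eqxx ?orbT.
Qed.

(** The bounds on the three terms of [card_chords_split] add up to exactly the total, so equality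
    leaves no slack in any of them. *)
Lemma full_split a c b : (a < c < b)%N -> full a b -> separates c a b ->
  [/\ (a, b) \in T, full a c & full c b].
Proof.
move=> /andP[ac cb] fab sep; have := card_chords_split sep.
have := card_chords_le ac; have := card_chords_le cb; move: fab; rewrite /full.
by case: (_ \in T) => /=; first split => //; lia.
Qed.

Lemma full_mem a b : (a < b)%N -> full a b -> (a, b) \in T.
Proof.
move=> ab fab; have [ab1|ab1] := ltnP a.+1 b; last by apply: T_side; lia.
have [c [acb _ sep]] := separating_vertex ab1.
by case: (full_split acb fab sep).
Qed.

Lemma full_triangle a b : (a.+1 < b)%N -> full a b -> exists c, is_triangle T a c b.
Proof.
move=> ab fab; have [c [acb acT sep]] := separating_vertex ab.
have [abT _ fcb] := full_split acb fab sep.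
exists c; split=> //; apply: full_mem => //; by case/andP: acb.
Qed.

(** * Distinguished edges and the triangle at each middle vertex *)

Lemma triangle_separates a c b : is_triangle T a c b -> separates c a b.
Proof.
case=> /andP[ac cb] acT cbT abT [x y] xyT /= ax yb xyN.
have [|cy] := leqP y c; [by left|have [|xc] := leqP c x; [by right|exfalso]].
have [xa|xa] := eqVneq (x : nat) a; last by apply: (noncrossing acT xyT); split=> //; lia.
have [yb'|yb'] := eqVneq (y : nat) b; last by apply: (noncrossing xyT cbT); split=> //; lia.
by rewrite (val_inj xa) (val_inj yb') eqxx in xyN.
Qed.

(** Fullness stands for the geometric fact that removing [g] leaves triangulated polygons; both
    parts inherit it. *)
Lemma distinguished_full f : distinguished T f -> (f.1 < f.2)%N /\ full f.1 f.2.
Proof.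
elim=> [|a c b _ [_ /= fab] abc|a c b _ [_ /= fab] abc] /=.
- by split=> //; apply: full_root.
- have sep := triangle_separates abc; case: abc => acb _ _ _.
  by have [_] := full_split acb fab sep; case/andP: acb.
- have sep := triangle_separates abc; case: abc => acb _ _ _.
  by have [_] := full_split acb fab sep; case/andP: acb.
Qed.

Lemma distinguished_triangle a b : distinguished T (a, b) -> (a.+1 < b)%N ->
  exists c, is_triangle T a c b.
Proof. by move=> /distinguished_full[_ fab] ab; apply: full_triangle. Qed.

(** If the two triangles differ at an end, a short edge of one at [k] crosses the long edge of the
    other. This makes [kL] and [kR] well defined. *)
Lemma triangle_unique a b a' b' k :
  is_triangle T a k b -> is_triangle T a' k b' -> a = a' /\ b = b'.
Proof.
case=> /andP[ak kb] akT kbT abT [/andP[ak' kb'] akT' kbT' abT'].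
split; apply: val_inj => /=; apply: contrapT => h.
- have [aa|aa] := ltnP a a'; first by apply: (noncrossing akT abT'); split=> //; lia.
  by apply: (noncrossing akT' abT); split=> //; lia.
- have [aa|aa] := ltnP b b'; first by apply: (noncrossing abT kbT'); split=> //; lia.
  by apply: (noncrossing abT' kbT); split=> //; lia.
Qed.

Lemma distinguished_side a b : b = a.+1 :> nat -> distinguished T (a, b).
Proof.
move=> ab.
suff H m (x y : 'I_n.+2) : (y - x < m)%N -> distinguished T (x, y) ->
    (x <= a)%N -> (b <= y)%N -> distinguished T (a, b).
  by apply: (H _ _ _ (ltnSn _) (dist_root T)) => //=; have := ltn_ord b; lia.
elim: m x y => // m IH x y hm dxy xa byl.
have [xy1|xy1] := ltnP x.+1 y; last first.
  suff -> : (a, b) = (x, y) by [].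
  by congr (_, _); apply: val_inj => /=; lia.
have [c xcy] := distinguished_triangle dxy xy1.
have [/andP[xc cy] _ _ _] := xcy.
have [ac|ca] := ltnP a c.
  by apply: (IH x c) => //; [lia|apply: dist_left dxy xcy|lia].
by apply: (IH c y) => //; [lia|apply: dist_right dxy xcy].
Qed.

Lemma kLE a k b : distinguished T (a, b) -> is_triangle T a k b -> kL T k = a.
Proof.
move=> dab akb; rewrite /kL; case: xgetP => [j _ [_ jk]|/(_ a) []]; last first.
  by split; [case: akb => /andP[]|apply: label_left dab akb].
have [b' jkb] : exists b', is_triangle T j k b'.
  by rewrite /left_tree /= in jk; inversion jk; subst; exists b0.
by case: (triangle_unique akb jkb).
Qed.

Lemma kRE a k b : distinguished T (a, b) -> is_triangle T a k b -> kR T k = b.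
Proof.
move=> dab akb; rewrite /kR; case: xgetP => [j _ [_ jk]|/(_ b) []]; last first.
  by split; [case: akb => /andP[]|apply: label_right dab akb].
have [a' akj] : exists a', is_triangle T a' k j.
  by rewrite /right_tree /= in jk; inversion jk; subst; exists a0.
by case: (triangle_unique akb akj).
Qed.

(** Descending from the root into the part containing [k] shortens the base until the middle vertex
    is [k]. *)
Lemma brack_triangle k : brack k ->
  distinguished T (kL T k, kR T k) /\ is_triangle T (kL T k) k (kR T k).
Proof.
rewrite /brack /= => hk.
suff [a [b [dab akb]]] : exists a b, distinguished T (a, b) /\ is_triangle T a k b.
  by rewrite (kLE dab akb) (kRE dab akb).
suff H m (x y : 'I_n.+2) : (y - x < m)%N -> distinguished T (x, y) -> (x < k < y)%N ->
    exists a b, distinguished T (a, b) /\ is_triangle T a k b.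
  by apply: (H _ _ _ (ltnSn _) (dist_root T)) => /=; lia.
elim: m x y => // m IH x y hm dxy /andP[xk ky].
have xy1 : (x.+1 < y)%N by lia.
have [c xcy] := distinguished_triangle dxy xy1.
have [/andP[xc cy] _ _ _] := xcy.
case: (ltngtP k c) => [kc|ck|kc].
- by apply: (IH x c) => //; [lia|apply: dist_left dxy xcy|lia].
- by apply: (IH c y) => //; [lia|apply: dist_right dxy xcy|lia].
- by exists x, y; rewrite (val_inj kc).
Qed.

End Triangulation.

(** * Fans of cones with unique complementary coordinates *)

Lemma sum_Zbasis_real (R : realType) n r (b : 'I_r -> lattice n) (c : 'I_r -> int) :
  lattice_incl R (\sum_k b k *~ c k) = \sum_k (c k)%:~R *: lattice_incl R (b k).
Proof.
rewrite raddf_sum; apply: eq_bigr => k _.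
by rewrite raddfMz scaler_int.
Qed.

Lemma lattice_incl_spans (R : realType) n (x : realspace R n) :
  exists (d : 'I_n.+1 -> R) (e : 'I_n.+1 -> lattice n),
    x = \sum_i d i *: lattice_incl R (e i).
Proof.
have [y ->] := proj_diag_surj x.
exists (fun i => y 0 i), (fun i => proj_diag (delta_mx 0 i)).
rewrite [in LHS](row_sum_delta y) raddf_sum; apply: eq_bigr => i _.
rewrite lattice_inclE -linearZ /=; congr proj_diag; congr (_ *: _).
by apply/matrixP => p q; rewrite !mxE; case: (_ && _).
Qed.

Section SplitFan.
Variables (R : realType) (n r : nat).
Local Notation NR := (realspace R n).
Local Notation J := ('I_r * bool)%type.
Variable U : J -> lattice n.
Local Notation UR j := (lattice_incl R (U j)).

Definition combination (c : J -> R) : NR := \sum_j c j *: UR j.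

Definition complementary (c : J -> R) : Prop :=
  (forall j, 0 <= c j) /\ (forall k, c (k, true) = 0 \/ c (k, false) = 0).

Definition transversal_set (A : set J) : Prop :=
  forall k, ~ (A (k, true) /\ A (k, false)).

(** A conic combination may repeat generators; adding the coefficients with equal index gives one
    function on [J]. *)
Lemma lcone_combination (A : set J) x :
  lcone R (U @` A) x <->
  exists c, [/\ forall j, 0 <= c j, forall j, ~ A j -> c j = 0 & x = combination c].
Proof.
split=> [[m [u [c [uA c0 ->]]]]|[c [c0 cA ->]]].
  have /choice[g gP] : forall i, exists j, A j /\ UR j = u i.
    move=> i; have [_ [j Aj <-] <-] := uA i; by exists j.
  exists (fun j => \sum_(i | g i == j) c i); split.
  - by move=> j; apply: sumr_ge0.
  - move=> j nA; rewrite big1 // => i /eqP gi; case: nA; rewrite -gi.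
    by case: (gP i).
  - rewrite /combination (partition_big g xpredT) //=; apply: eq_bigr => j _.
    rewrite scaler_suml; apply: eq_bigr => i /eqP <-.
    by case: (gP i) => _ ->.
pose B := [pred j | `[< A j >]].
exists #|B|, (fun i => UR (enum_val i)), (fun i => c (enum_val i)); split=> //.
  move=> i; have Ai : A (enum_val i) by apply/asboolP; exact: (enum_valP i).
  by exists (U (enum_val i)) => //; exists (enum_val i).
rewrite /combination (bigID (mem B)) /= [X in _ + X]big1 ?addr0.
  by rewrite big_enum_val.
by move=> j /asboolP/cA ->; rewrite scale0r.
Qed.

Lemma combination_section (eps : 'I_r -> bool) (d : 'I_r -> R) :
  combination (fun j => if j.2 == eps j.1 then d j.1 else 0) =
  \sum_k d k *: UR (k, eps k).
Proof.
rewrite /combination.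
rewrite (eq_bigr (fun j => (if j.2 == eps j.1 then d j.1 else 0) *: UR (j.1, j.2)));
  last by case.
rewrite -(pair_bigA _ (fun k b => (if b == eps k then d k else 0) *: UR (k, b))) /=.
by apply: eq_bigr => k _; rewrite big_bool /=; case: (eps k);
  rewrite /= scale0r ?addr0 ?add0r.
Qed.

Lemma combination1 (i : J) : combination (fun j => (j == i)%:R) = UR i.
Proof.
rewrite /combination (bigD1 i) //= eqxx scale1r big1 ?addr0 // => j /negPf ->.
by rewrite scale0r.
Qed.

(** * Bases obtained by choosing one generator from each pair *)

Hypothesis Zspan : forall (eps : 'I_r -> bool) (x : lattice n),
  exists c : 'I_r -> int, x = \sum_k U (k, eps k) *~ c k.
Hypothesis exists_complementary : forall x : NR,
  exists2 c, complementary c & x = combination c.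
Hypothesis unique_complementary : forall c d, complementary c ->
  complementary d -> combination c = combination d -> c =1 d.

Lemma section_free (eps : 'I_r -> bool) (d d' : 'I_r -> R) :
  \sum_k d k *: UR (k, eps k) = \sum_k d' k *: UR (k, eps k) -> d =1 d'.
Proof.
move=> dd'.
(* The positive and negative parts of [d - d'] are both complementary and represent the same vector,
   so uniqueness makes them equal. *)
pose pos (x : R) := Num.max x 0.
have posE x : pos x - pos (- x) = x by rewrite /pos /Num.max; do 2 case: ifP; lra.
have compl (p : 'I_r -> R) :
    complementary (fun j => if j.2 == eps j.1 then pos (p j.1) else 0).
  split=> [j|k] /=; first by case: ifP => // _; rewrite /pos le_max lexx orbT.
  by case: (eps k); [right|left].
pose e k := d k - d' k.
have H : combination (fun j => if j.2 == eps j.1 then pos (e j.1) else 0) =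
         combination (fun j => if j.2 == eps j.1 then pos (- e j.1) else 0).
  apply/eqP; rewrite -subr_eq0 (combination_section _ (fun k => pos (e k))).
  rewrite (combination_section _ (fun k => pos (- e k))) -sumrB; apply/eqP.
  rewrite (eq_bigr (fun k => d k *: UR (k, eps k) - d' k *: UR (k, eps k))).
    by rewrite sumrB dd' subrr.
  by move=> k _; rewrite -scalerBl posE scalerBl.
move=> k; have := unique_complementary (compl e) (compl (fun k => - e k)) H (k, eps k).
by rewrite /= eqxx => h; have := posE (e k); rewrite h subrr /e; lra.
Qed.

Lemma section_spans (eps : 'I_r -> bool) (x : NR) :
  exists d : 'I_r -> R, x = \sum_k d k *: UR (k, eps k).
Proof.
have [d [e ->]] := lattice_incl_spans x.
have /choice[c cP] := fun i => Zspan eps (e i).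
exists (fun k => \sum_i d i * (c i k)%:~R).
under eq_bigr => i _ do rewrite [in X in _ *: X]cP sum_Zbasis_real scaler_sumr.
rewrite exchange_big /=; apply: eq_bigr => k _; rewrite scaler_suml.
by apply: eq_bigr => i _; rewrite scalerA.
Qed.

Lemma section_Zbasis (eps : 'I_r -> bool) : is_Zbasis (fun k => U (k, eps k)).
Proof.
move=> x; have [c xc] := Zspan eps x.
exists (finfun c); split; first by rewrite xc; apply: eq_bigr => k _; rewrite ffunE.
move=> c' xc'; apply/ffunP => k; rewrite ffunE.
have := congr1 (@lattice_incl R n) (etrans (esym xc) xc').
by rewrite !sum_Zbasis_real => /section_free /(_ k) /intr_inj.
Qed.

(** These functionals support the faces in [lcone_sub_face]; freeness makes the chosen coordinates
    linear. *)
Lemma section_functional (eps : 'I_r -> bool) (B : pred 'I_r) :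
  exists m : {scalar NR}, forall d : 'I_r -> R,
    m (\sum_k d k *: UR (k, eps k)) = \sum_(k | B k) d k.
Proof.
have /choice[f fP] := section_spans eps.
pose g (x : NR) := \sum_(k | B k) f x k.
have gE d : g (\sum_k d k *: UR (k, eps k)) = \sum_(k | B k) d k.
  by apply: eq_bigr => k _; exact: (section_free (esym (fP _)) k).
have g_lin : linear_for *%R g.
  move=> a x y; rewrite [in LHS](fP x) [in LHS](fP y) scaler_sumr -big_split /=.
  rewrite (eq_bigr (fun k => (a * f x k + f y k) *: UR (k, eps k))); last first.
    by move=> k _; rewrite scalerA -scalerDl.
  by rewrite gE big_split /= -mulr_sumr.
pose mL := GRing.isLinear.Build R NR R *%R g g_lin.
pose m : {scalar NR} := HB.pack g mL.
by exists m.
Qed.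

(** * Complementary coordinates and membership in cones *)

Definition coord (x : NR) : J -> R := sval (cid2 (exists_complementary x)).

Lemma coord_complementary x : complementary (coord x).
Proof. by rewrite /coord; case: cid2. Qed.

Lemma coordK x : combination (coord x) = x.
Proof. by rewrite /coord; case: cid2. Qed.

Lemma combinationK c : complementary c -> coord (combination c) =1 c.
Proof.
move=> cc; apply: unique_complementary => //; last exact: coordK.
exact: coord_complementary.
Qed.

Lemma transversal_complementary (A : set J) (c : J -> R) : transversal_set A ->
  (forall j, 0 <= c j) -> (forall j, ~ A j -> c j = 0) -> complementary c.
Proof.
move=> trA c0 cA; split=> // k.
have [At|nAt] := pselect (A (k, true)); last by left; apply: cA.
by right; apply: cA => Af; apply: (trA k).
Qed.

Lemma coord_generator (i : J) : coord (UR i) =1 (fun j => (j == i)%:R).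
Proof.
rewrite -combination1; apply: combinationK.
apply: (@transversal_complementary [set i]) => [k [] /= <- //|j|j ji]; first exact: ler0n.
by case: eqP => // /ji.
Qed.

(** Nonnegative coefficients supported in a transversal set are complementary, so uniqueness
    identifies them with [coord x]. *)
Lemma mem_lcone (A : set J) x : transversal_set A ->
  lcone R (U @` A) x <-> (forall j, ~ A j -> coord x j = 0).
Proof.
move=> trA; rewrite lcone_combination; split=> [[c [c0 cA ->]] j nAj|xA].
  by rewrite combinationK ?cA //; apply: transversal_complementary trA c0 cA.
exists (coord x); split=> //; last by rewrite coordK.
by case: (coord_complementary x).
Qed.

Lemma mem_lcone_generator (A : set J) j : transversal_set A ->
  lcone R (U @` A) (UR j) <-> A j.
Proof.
move=> trA; rewrite mem_lcone //; split=> [H|Aj i nAi]; last first.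
  by rewrite coord_generator; case: eqP => // ij; rewrite ij in nAi.
by apply: contrapT => /H; rewrite coord_generator eqxx => /eqP; rewrite oner_eq0.
Qed.

Lemma lcone_sub (P : set (lattice n)) u : P u -> lcone R P (lattice_incl R u).
Proof.
move=> Pu; exists 1%N, (fun=> lattice_incl R u), (fun=> 1); split.
- by move=> _; exists u.
- by move=> _; apply: ler01.
- by rewrite big_ord1 scale1r.
Qed.

(** * The fan axioms, completeness and non-singularity *)

Definition split_fan : set (set NR) := [set lcone R (U @` A) | A in transversal_set].

(** A cone could a priori also be generated by another index set. A transversal one contains the
    index of every generator lying in its cone, hence all of [A]. *)
Lemma split_fanE (A : set J) : split_fan (lcone R (U @` A)) <-> transversal_set A.
Proof.
split=> [[B trB BA] k [At Af]|trA]; last by exists A.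
by apply: (trB k); split; rewrite -mem_lcone_generator // BA; apply: lcone_sub;
  eexists; try reflexivity.
Qed.

Lemma generator_inj : injective U.
Proof.
move=> i j Uij; have := coord_generator i i; rewrite Uij coord_generator eqxx.
by case: eqP => // _ /eqP; rewrite eq_sym oner_eq0.
Qed.

(** Extends a transversal [A] to a full choice, taking [false] at the pairs that [A] misses. *)
Definition section_of (A : set J) (k : 'I_r) : bool := `[< A (k, true) >].

Lemma section_ofP (A : set J) j : transversal_set A -> A j -> j.2 = section_of A j.1.
Proof.
case: j => k [] trA Aj; rewrite /section_of /=; first by rewrite asboolT.
by rewrite asboolF // => At; apply: (trA k).
Qed.

Lemma combination_transversal (A : set J) (c : J -> R) : transversal_set A ->
  (forall j, ~ A j -> c j = 0) ->
  combination c = \sum_k c (k, section_of A k) *: UR (k, section_of A k).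
Proof.
move=> trA cA; rewrite -combination_section; apply: eq_bigr => -[k b] _ /=.
case: eqP => [<- //|nb]; rewrite cA // => Aj; apply: nb.
exact: (section_ofP trA Aj).
Qed.

Lemma sub_transversal (A B : set J) : B `<=` A -> transversal_set A -> transversal_set B.
Proof. by move=> BA trA k [/BA At /BA Af]; apply: (trA k). Qed.

(** The supporting functional adds the coordinates in [A] but not in [B]; being nonnegative on the
    cone, they all vanish when the sum does. *)
Lemma lcone_sub_face (A B : set J) : transversal_set A -> B `<=` A ->
  is_face (lcone R (U @` B)) (lcone R (U @` A)).
Proof.
move=> trA BA; have trB := sub_transversal BA trA.
pose e := section_of A.
have [m mE] := section_functional e
  (fun k => `[< A (k, e k) /\ ~ B (k, e k) >]).
have mA x : lcone R (U @` A) x ->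
    m x = \sum_(k | `[< A (k, e k) /\ ~ B (k, e k) >]) coord x (k, e k).
  by move=> /(mem_lcone _ trA) xA; rewrite -{1}(coordK x) (combination_transversal trA xA) mE.
have x0 x j : 0 <= coord x j by case: (coord_complementary x).
exists m; split=> [x xA|]; first by rewrite mA //; apply: sumr_ge0.
apply/seteqP; split=> x /=.
  move=> /(mem_lcone _ trB) xB.
  have xA : lcone R (U @` A) x by apply/mem_lcone => // j nA; apply: xB => /BA.
  split=> //; rewrite mA // big1 // => k /asboolP[_ nB]; exact: xB.
move=> [xA]; rewrite mA // => /eqP; rewrite psumr_eq0 // => /allP m0.
apply/mem_lcone => // -[k b] nB.
have [Aj|nA] := pselect (A (k, b)); last by move/(mem_lcone _ trA): xA; apply.
have bE := section_ofP trA Aj; rewrite /= in bE.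
have := m0 k (mem_index_enum _).
by rewrite -[e k]bE asboolT //= => /eqP.
Qed.

(** On the cone, [m x] is a sum of nonnegative terms, so it vanishes only if [x] uses just the
    generators killed by [m]. *)
Lemma face_lcone (A : set J) (tau : set NR) : transversal_set A ->
  is_face tau (lcone R (U @` A)) -> exists2 B, B `<=` A & tau = lcone R (U @` B).
Proof.
move=> trA [m [m0 ->]].
exists [set j | A j /\ m (UR j) = 0]; first by move=> j [].
have trB : transversal_set [set j | A j /\ m (UR j) = 0].
  by apply: sub_transversal trA => j [].
have x0 x j : 0 <= coord x j by case: (coord_complementary x).
have mE x : m x = \sum_j coord x j * m (UR j).
  by rewrite -{1}(coordK x) linear_sum; apply: eq_bigr => j _; rewrite linearZ.
apply/seteqP; split=> x /=.
  move=> [/(mem_lcone _ trA) xA /eqP]; rewrite mE psumr_eq0 => [/allP mx|j _].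
    apply/mem_lcone => // j nB.
    have [Aj|] := pselect (A j); last exact: xA.
    have := mx j (mem_index_enum _); rewrite /= mulf_eq0 => /orP[/eqP //|/eqP mj].
    by case: nB.
  have [Aj|/xA ->] := pselect (A j); last by rewrite mul0r.
  by apply: mulr_ge0 => //; apply: m0; apply: lcone_sub; exists j.
move=> /(mem_lcone _ trB) xB.
have xA : lcone R (U @` A) x by apply/mem_lcone => // j nA; apply: xB => -[/nA].
split=> //; rewrite mE big1 // => j _.
have [[_ ->]|nB] := pselect (A j /\ m (UR j) = 0); first by rewrite mulr0.
by rewrite (xB j nB) mul0r.
Qed.

Lemma lcone_setI (A B : set J) : transversal_set A -> transversal_set B ->
  lcone R (U @` A) `&` lcone R (U @` B) = lcone R (U @` (A `&` B)).
Proof.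
move=> trA trB.
have trAB : transversal_set (A `&` B) by apply: sub_transversal trA => j [].
apply/seteqP; split=> x /=; rewrite !mem_lcone //.
  by move=> [xA xB] j /not_andP[/xA|/xB].
by move=> xAB; split=> j nj; apply: xAB => -[].
Qed.

Lemma split_fan_finite : finite_set split_fan.
Proof.
apply: (sub_finite_set (B := (fun A : {set J} => lcone R (U @` [set` A])) @` setT)).
  move=> _ [A _ <-]; exists [set j | `[< A j >]]%SET => //.
  congr (lcone R (U @` _)); apply/seteqP; split=> j /=; rewrite finset.inE.
    exact: asboolW.
  by move=> Aj; apply/asboolP.
apply: finite_image; exact: finite_finset.
Qed.

(** The coordinates of [x] and [- x] add up to a complementary expression of 0, which must be the
    zero one. *)
Lemma split_fan_strongly_convex (A : set J) : transversal_set A ->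
  strongly_convex (lcone R (U @` A)).
Proof.
move=> trA x /(mem_lcone _ trA) xA /(mem_lcone _ trA) xA'.
have x0 y j : 0 <= coord y j by case: (coord_complementary y).
have zero : complementary (fun=> 0) by split=> // k; left.
have sum : complementary (fun j => coord x j + coord (- x) j).
  apply: (transversal_complementary trA) => j; first exact: addr_ge0.
  by move=> nA; rewrite xA ?xA' ?addr0.
have E : combination (fun j => coord x j + coord (- x) j) = combination (fun=> 0).
  transitivity (combination (coord x) + combination (coord (- x))).
    by rewrite /combination -big_split; apply: eq_bigr => j _; rewrite scalerDl.
  by rewrite !coordK subrr /combination big1 // => j _; rewrite scale0r.
rewrite -(coordK x) /combination big1 // => j _.
have := unique_complementary sum zero E j => /= /eqP.
by rewrite paddr_eq0 // => /andP[/eqP -> _]; rewrite scale0r.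
Qed.

Lemma split_fan_is_fan : is_fan split_fan.
Proof.
split.
- exact: split_fan_finite.
- move=> _ [A trA <-]; split; last exact: split_fan_strongly_convex.
  by exists (U @` A); split=> //; apply: finite_image.
- move=> _ tau [A trA <-] /(face_lcone trA)[B BA ->].
  by exists B => //; apply: sub_transversal trA.
- move=> _ _ [A trA <-] [B trB <-]; rewrite lcone_setI //.
  by split; apply: lcone_sub_face => // j [].
Qed.

Lemma split_fan_complete : is_complete split_fan.
Proof.
move=> x; exists (lcone R (U @` [set j | coord x j != 0])).
  apply/split_fanE => k /= [].
  by case: (coord_complementary x) => _ /(_ k)[] ->; rewrite eqxx.
apply/lcone_combination; exists (coord x); split; last by rewrite coordK.
- by case: (coord_complementary x).
- by move=> j /negP; rewrite negbK => /eqP.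
Qed.

Lemma split_fan_nonsingular : is_nonsingular split_fan.
Proof.
move=> _ [A trA <-]; pose e := section_of A.
exists r, (fun k => U (k, e k)), [set k | A (k, e k)]; split.
  exact: section_Zbasis.
congr (lcone R _); apply/seteqP; split=> [_ [[k b] Aj <-]|_ [k Ak <-]].
  have bE := section_ofP trA Aj; rewrite /= in bE; subst b.
  by exists k.
by exists (k, e k).
Qed.

(** * Ray vectors and primitive collections *)

Lemma generator_primitive j : is_primitive (U j).
Proof.
case: j => k b.
have bas := section_Zbasis (fun=> b).
have [c [_ cU]] := bas (U (k, b)).
have U1 : [ffun i => (i == k)%:R] = c.
  symmetry; apply: cU.
  rewrite (bigD1 k) //= ffunE eqxx mulr1z big1 ?addr0 // => i /negPf ik.
  by rewrite ffunE ik mulr0z.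
split.
  apply/eqP => U0.
  have /ffunP/(_ k) : c = [ffun=> 0].
    by apply: cU; rewrite U0 big1 // => i _; rewrite ffunE mulr0z.
  by rewrite -U1 !ffunE eqxx => /eqP; rewrite oner_eq0.
move=> m u' Um; have [c' [u'E _]] := bas u'.
have /ffunP/(_ k) : c = [ffun i => c' i *+ m].
  apply: cU; rewrite Um u'E -sumrMnl; apply: eq_bigr => i _.
  by rewrite ffunE pmulrn -mulrzA -[(m : int)]natz mulr_natr.
rewrite -U1 !ffunE eqxx -(mulr_natr (c' k)) => /(congr1 absz) /esym/eqP.
by rewrite abszM muln_eq1 natz => /andP[_ /eqP].
Qed.

Lemma ray_generator u : is_primitive u -> split_fan (lcone R [set u]) ->
  exists j, u = U j.
Proof.
move=> [u0 uprim] [A trA uA].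
have [[j Aj]|nA] := pselect (exists j, A j); last first.
  have : lcone R (U @` A) (lattice_incl R u) by rewrite uA; apply: lcone_sub.
  move=> /(mem_lcone _ trA) uz; move: u0.
  have [c uE] := Zspan (fun=> true) u.
  have iu : lattice_incl R u = \sum_k 0 *: UR (k, true).
    rewrite -(coordK (lattice_incl R u)) /combination.
    rewrite !big1 // => [k _|j _]; first by rewrite scale0r.
    by rewrite uz ?scale0r // => Aj; apply: nA; exists j.
  rewrite {1}uE sum_Zbasis_real in iu.
  rewrite uE big1 ?eqxx // => k _.
  have := section_free iu k => /eqP.
  by rewrite intr_eq0 => /eqP ->; rewrite mulr0z.
have : lcone R [set u] (UR j) by rewrite -uA; apply: lcone_sub; exists j.
move=> [m [v [d [vu d0 jE]]]].
pose t := \sum_i d i.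
have t0 : 0 <= t by apply: sumr_ge0.
have {vu}jE : UR j = t *: lattice_incl R u.
  rewrite {}jE scaler_suml; apply: eq_bigr => i _.
  by have [_ -> <-] := vu i.
case: j Aj jE => k b _ jE.
(* Expanding in a lattice basis through [U (k, b)] shows that [u] is a nonnegative integer multiple
   of it; primitivity then makes the multiple 1. *)
have [c uE] := Zspan (fun=> b) u.
have tc : (fun i => (i == k)%:R) =1 (fun i => t * (c i)%:~R).
  apply: (section_free (eps := fun=> b)); rewrite (bigD1 k) //= eqxx scale1r big1 ?addr0.
    rewrite jE {1}uE sum_Zbasis_real scaler_sumr.
    by apply: eq_bigr => i _; rewrite scalerA.
  by move=> i /negPf ->; rewrite scale0r.
have tck := tc k; rewrite eqxx in tck.
have tn0 : t != 0 by apply/eqP => tz; move: tck; rewrite tz mul0r => /eqP; rewrite oner_eq0.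
have ck : 0 <= c k.
  rewrite -(ler0z R) -(pmulr_rge0 _ (_ : 0 < t)); first by rewrite -tck ler01.
  by rewrite lt0r tn0.
exists (k, b).
have uE' : u = U (k, b) *+ `|c k|%N.
  rewrite pmulrn gez0_abs // uE (bigD1 k) //= big1 ?addr0 // => i ik.
  have := tc i; rewrite (negPf ik) => /esym/eqP.
  by rewrite mulf_eq0 (negPf tn0) intr_eq0 => /eqP ->; rewrite mulr0z.
by rewrite uE' (uprim _ _ uE') mulr1n.
Qed.

Lemma ray_vectors_split_fan : ray_vectors split_fan = range U.
Proof.
apply/seteqP; split=> [u [up uS]|_ [j _ <-]].
  by have [j ->] := ray_generator up uS; exists j.
split; first exact: generator_primitive.
rewrite -(image_set1 U j); apply/split_fanE => k [<-] //.
Qed.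

Lemma image_preimage_generator (P : set (lattice n)) : P `<=` range U ->
  P = U @` (U @^-1` P).
Proof.
move=> PU; apply/seteqP; split=> [u Pu|_ [j Pj <-] //].
by have [j _ ju] := PU u Pu; exists j; rewrite /preimage /= ?ju.
Qed.

Lemma split_fan_lcone (P : set (lattice n)) : P `<=` range U ->
  split_fan (lcone R P) <->
  (forall k, ~ [set U (k, true); U (k, false)] `<=` P).
Proof.
move=> PU; rewrite {1}(image_preimage_generator PU) split_fanE; split.
  by move=> tr k sub; apply: (tr k); split; apply: sub; [left|right].
by move=> tr k [Pt Pf]; apply: (tr k) => _ [] ->.
Qed.

Lemma primitive_collections_split_fan :
  primitive_collections split_fan =
  [set [set U (k, true); U (k, false)] | k in setT].
Proof.
apply/seteqP; split=> [P [PU nP Pu]|_ [k _ <-]].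
  rewrite ray_vectors_split_fan in PU.
  have [k kP] : exists k, [set U (k, true); U (k, false)] `<=` P.
    by apply: contrapT => /forallNP H; apply/nP/split_fan_lcone.
  exists k => //; apply/seteqP; split=> // u uP; apply: contrapT => nu.
  have sub : P `\ u `<=` range U by move=> x [/PU].
  (* Removing an element outside the pair would keep the pair, yet give a cone of the fan. *)
  have [+ _] := split_fan_lcone sub.
  move=> /(_ (Pu u uP) k); apply=> x xk; split; first exact: kP.
  by move=> /= xu; apply: nu; rewrite -xu.
have sub : [set U (k, true); U (k, false)] `<=` range U by move=> _ [] ->; eexists.
split; first by rewrite ray_vectors_split_fan.
  by rewrite split_fan_lcone // => /(_ k); apply.
move=> u uk; apply/split_fan_lcone => [x [/sub]//|i].
move=> isub.
have [h1 n1] : ([set U (k, true); U (k, false)] `\ u) (U (i, true)) by apply: isub; left.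
have [h2 n2] : ([set U (k, true); U (k, false)] `\ u) (U (i, false)) by apply: isub; right.
have ik : i = k by case: h1 => /generator_inj[].
by case: uk => uk; [apply: n1|apply: n2]; rewrite /= uk ik.
Qed.
End SplitFan.

(** * The vectors of a triangulation *)

Fixpoint runmin (R : realType) (y : nat -> R) a l : R :=
  if l is l'.+1 then Num.min (runmin y a l') (y (a + l)%N) else y a.

(** [runmin y a l] ranges over [l + 1] values, so blocks with parameters [l] and [m] join to
    parameter [l + m + 1]. *)
Lemma runmin_cat (R : realType) (y : nat -> R) a l m :
  runmin y a (l + m).+1 = Num.min (runmin y a l) (runmin y (a + l).+1 m).
Proof.
elim: m => [|m IH]; first by rewrite addn0 /= addnS.
rewrite addnS -[LHS]/(Num.min (runmin y a (l + m).+1) (y (a + (l + m).+2)%N)).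
by rewrite IH /= -minA; congr (Num.min _ (Num.min _ (y _))); lia.
Qed.

Lemma varpiE n (i : 'I_n.+2) :
  varpi i = proj_diag (\row_(k < n.+1) ((k < i)%N)%:R).
Proof.
rewrite /varpi; congr proj_diag; apply/rowP => k; rewrite summxE mxE big_mkcond /=.
rewrite (bigD1 k) //= big1 => [|j jk]; first by rewrite addr0 mxE !eqxx; case: ifP.
by rewrite mxE eq_sym (negPf jk) andbF if_same.
Qed.

Lemma lattice_incl_varpi (R : realType) n (i : 'I_n.+2) :
  lattice_incl R (varpi i) = proj_diag (\row_(k < n.+1) ((k < i)%N)%:R).
Proof.
rewrite varpiE lattice_inclE; congr proj_diag; apply/rowP => k.
by rewrite !mxE; case: (_ < _)%N.
Qed.

Definition inner n (k : 'I_n) : 'I_n.+2 := lift ord0 (widen_ord (leqnSn n) k).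

Lemma inner_inj n : injective (@inner n).
Proof. by move=> i k /(congr1 val) /= [] /val_inj. Qed.

Lemma brack_inner n (k : 'I_n) : brack (inner k).
Proof. by rewrite /brack /= ltn_ord. Qed.

Lemma brackP n (i : 'I_n.+2) : brack i -> exists k : 'I_n, i = inner k.
Proof.
rewrite /brack /= => hi.
have hk : (i.-1 < n)%N by lia.
by exists (Ordinal hk); apply: val_inj; rewrite /= /bump; lia.
Qed.

Section TriangulationVectors.
Variables (n : nat) (T : {set edge n}).
Hypothesis hT : is_triangulation T.
Local Notation J := ('I_n * bool)%type.

(** [true] selects the edge giving [v_k], [false] the one giving [w_k]. *)
Definition apex_edge (j : J) : edge n :=
  if j.2 then (inner j.1, kR T (inner j.1)) else (kL T (inner j.1), inner j.1).

Definition edge_vector (f : edge n) : lattice n := varpi f.1 - varpi f.2.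

Definition apex_vector (j : J) : lattice n := edge_vector (apex_edge j).

Lemma inner_triangle (k : 'I_n) :
  distinguished T (kL T (inner k), kR T (inner k)) /\
  is_triangle T (kL T (inner k)) (inner k) (kR T (inner k)).
Proof. exact/(brack_triangle hT)/brack_inner. Qed.

Lemma triangle_apex a c b : distinguished T (a, b) -> is_triangle T a c b ->
  exists k, [/\ c = inner k, kL T (inner k) = a & kR T (inner k) = b].
Proof.
move=> dab acb.
have [k ck] : exists k : 'I_n, c = inner k.
  apply: brackP; have [/andP[ac cb] _ _ _] := acb.
  by rewrite /brack /=; have := ltn_ord b; lia.
by exists k; rewrite -ck (kLE hT dab acb) (kRE hT dab acb).
Qed.

Lemma apex_edge_mem j : apex_edge j \in T.
Proof.
case: j => k b; rewrite /apex_edge /=; have [_ [_ aT bT _]] := inner_triangle k.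
by case: b.
Qed.

Lemma apex_edge_lt j : ((apex_edge j).1 < (apex_edge j).2)%N.
Proof.
case: j => k b; rewrite /apex_edge /=; have [_ [/andP[aT bT] _ _ _]] := inner_triangle k.
by case: b.
Qed.

(** Any other edge of [T] covering [(a, c)] but ending before [b] would cross [(c, b)] or
    [(a, b)]. *)
Lemma covers_left a c b f : is_triangle T a c b -> f \in T ->
  (f.1 <= a)%N && (c <= f.2)%N =
  (f == (a, c)) || (f.1 <= a)%N && (b <= f.2)%N.
Proof.
case=> /andP[ac cb] acT cbT abT; case: f => x y xyT /=.
have [[-> ->]|xyN] := eqVneq (x, y) (a, c); first by rewrite leqnn leqnn.
apply/idP/idP => /andP[xa]; last by move=> h; apply/andP; split=> //; lia.
move=> cy /=; rewrite xa /= leqNgt; apply/negP => yb.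
have [cy'|cy'] := eqVneq (c : nat) y; last by apply: (noncrossing hT xyT cbT); split=> //; lia.
have [xa'|xa'] := eqVneq (x : nat) a; last by apply: (noncrossing hT xyT abT); split=> //; lia.
by rewrite (val_inj cy') (val_inj xa') eqxx in xyN.
Qed.

Lemma covers_right a c b f : is_triangle T a c b -> f \in T ->
  (f.1 <= c)%N && (b <= f.2)%N =
  (f == (c, b)) || (f.1 <= a)%N && (b <= f.2)%N.
Proof.
case=> /andP[ac cb] acT cbT abT; case: f => x y xyT /=.
have [[-> ->]|xyN] := eqVneq (x, y) (c, b); first by rewrite leqnn leqnn.
apply/idP/idP => /andP[xa]; last by move=> h; apply/andP; split=> //; lia.
move=> cy /=; rewrite cy andbT leqNgt; apply/negP => yb.
have [cy'|cy'] := eqVneq (b : nat) y; last by apply: (noncrossing hT abT xyT); split=> //; lia.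
have [xa'|xa'] := eqVneq (x : nat) c; last by apply: (noncrossing hT acT xyT); split=> //; lia.
by rewrite (val_inj cy') (val_inj xa') eqxx in xyN.
Qed.

(** An edge that is right short edge of one triangle and left short edge of another would make their
    long edges cross. *)
Lemma apex_edge_inj : injective apex_edge.
Proof.
have mixed k i : (inner k, kR T (inner k)) = (kL T (inner i), inner i) -> False.
  move=> h; have ki := congr1 fst h; have rk := congr1 snd h; rewrite /= in ki rk.
  have [_ [/andP[h1 h2] _ _ abT]] := inner_triangle k.
  have [_ [/andP[h3 h4] _ _ abT']] := inner_triangle i.
  by apply: (noncrossing hT abT abT'); split; rewrite -?ki ?rk //; rewrite -rk.
move=> [k []] [i []]; rewrite /apex_edge /=.
- by move=> /(congr1 fst)/inner_inj ->.
- by move=> /mixed.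
- by move=> /esym/mixed.
- by move=> /(congr1 snd)/inner_inj ->.
Qed.

(** * Cover sums and complementary expressions *)

Section Cover.
Variable (R : realType).
Local Notation UR j := (lattice_incl R (apex_vector j)).

Definition cover_sum (c : J -> R) (a b : nat) : R :=
  \sum_(j | ((apex_edge j).1 <= a)%N && (b <= (apex_edge j).2)%N) c j.

Lemma cover_sum_root c : cover_sum c 0 n.+1 = 0.
Proof.
rewrite /cover_sum big_pred0 // => -[k b].
have := brack_inner k; rewrite /brack /apex_edge /= /bump.
by case: b => /=; have := ltn_ord k; rewrite /bump; lia.
Qed.

Lemma cover_sum_left c k : let a := kL T (inner k) in let b := kR T (inner k) in
  cover_sum c a (inner k) = cover_sum c a b + c (k, false).
Proof.
move=> a b; have [_ akb] := inner_triangle k.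
rewrite /cover_sum (bigD1 (k, false)) /=; last by rewrite !leqnn.
rewrite addrC; congr (_ + _); apply: eq_bigl => j.
rewrite (covers_left akb (apex_edge_mem j)) -/a -/b.
have -> : (apex_edge j == (a, inner k)) = (j == (k, false)).
  by rewrite -(inj_eq apex_edge_inj).
case: eqVneq => [->|] //=; rewrite ?andbT //.
by have [/andP[]] := akb; rewrite /a /b /apex_edge /=; lia.
Qed.

Lemma cover_sum_right c k : let a := kL T (inner k) in let b := kR T (inner k) in
  cover_sum c (inner k) b = cover_sum c a b + c (k, true).
Proof.
move=> a b; have [_ akb] := inner_triangle k.
rewrite /cover_sum (bigD1 (k, true)) /=; last by rewrite !leqnn.
rewrite addrC; congr (_ + _); apply: eq_bigl => j.
rewrite (covers_right akb (apex_edge_mem j)) -/a -/b.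
have -> : (apex_edge j == (inner k, b)) = (j == (k, true)).
  by rewrite -(inj_eq apex_edge_inj).
case: eqVneq => [->|] //=; rewrite ?andbT //.
by have [/andP[]] := akb; rewrite /a /b /apex_edge /=; lia.
Qed.

(** Coordinate [i] of [varpi x - varpi y], for [x < y], is -1 when [x <= i < y] and 0 otherwise. *)
Lemma combination_cover c : combination apex_vector c =
  proj_diag (\row_(i < n.+1) - cover_sum c i i.+1).
Proof.
rewrite /combination.
under eq_bigr => j _ do
  rewrite /apex_vector /edge_vector lattice_inclB !lattice_incl_varpi -proj_diagB -proj_diagZ.
rewrite -raddf_sum /=; congr proj_diag; apply/rowP => i.
rewrite summxE mxE /cover_sum [in RHS]big_mkcond -sumrN; apply: eq_bigr => j _.
rewrite !mxE; have := apex_edge_lt j; move: (apex_edge j) => [x y] /= xy.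
case: (ltnP i x) => ix; case: (ltnP i y) => iy /=; rewrite ?subrr ?mulr0 ?oppr0 //; try lia.
by rewrite sub0r mulrN1.
Qed.

Lemma apex_unique (c d : J -> R) : complementary c -> complementary d ->
  combination apex_vector c = combination apex_vector d -> c =1 d.
Proof.
move=> [c0 c1] [d0 d1]; rewrite !combination_cover => /proj_diagP/diag_lineP[t tE].
have side (i : 'I_n.+1) : cover_sum d i i.+1 = cover_sum c i i.+1 + t.
  by have := congr1 (fun M : 'rV_n.+1 => M 0 i) tE; rewrite !mxE; lra.
(* For complementary coefficients the cover sum of a base is the minimum of those of its two short
   edges, so the common shift [t] propagates from the sides upwards. *)
have main m (a b : 'I_n.+2) : (b - a < m)%N -> distinguished T (a, b) ->
    cover_sum d a b = cover_sum c a b + t.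
  elim: m a b => // m IH a b hm dab.
  have [/= ab _] := distinguished_full hT dab.
  have [ab1|ab1] := ltnP a.+1 b; last first.
    have bE : b = a.+1 :> nat by lia.
    have an : (a < n.+1)%N by have := ltn_ord b; lia.
    by rewrite bE; exact: (side (Ordinal an)).
  have [e aeb] := distinguished_triangle hT dab ab1.
  have [/andP[ae eb] _ _ _] := aeb.
  have [k [ek ka kb]] := triangle_apex dab aeb.
  have IHl : cover_sum d a e = cover_sum c a e + t.
    by apply: IH; [lia|apply: dist_left dab aeb].
  have IHr : cover_sum d e b = cover_sum c e b + t.
    by apply: IH; [lia|apply: dist_right dab aeb].
  move: IHl IHr; rewrite ek -ka -kb !cover_sum_left !cover_sum_right.
  have := c0 (k, true); have := c0 (k, false).
  have := d0 (k, true); have := d0 (k, false).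
  by case: (c1 k) => ->; case: (d1 k) => ->; lra.
move=> [k b]; have [dk tk] := inner_triangle k.
have := main _ _ _ (ltnSn _) dk.
case: b.
  have := main _ _ _ (ltnSn _) (dist_right dk tk); rewrite !cover_sum_right; lra.
have := main _ _ _ (ltnSn _) (dist_left dk tk); rewrite !cover_sum_left; lra.
Qed.

Lemma apex_exists (x : realspace R n) :
  exists2 c, complementary c & x = combination apex_vector c.
Proof.
have [Y ->] := proj_diag_surj x.
pose y (i : nat) := - Y 0 (inord i).
pose mu (a b : nat) := runmin y a (b - a).-1.
have mu_split a e b : (a < e < b)%N -> mu a b = Num.min (mu a e) (mu e b).
  move=> /andP[ae eb]; rewrite /mu.
  have -> : (b - a).-1 = ((e - a).-1 + (b - e).-1).+1 by lia.
  by rewrite runmin_cat; congr (Num.min _ (runmin _ _ _)); lia.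
(* The coefficient of a short edge is the increase of the minimum from the base of its triangle, so
   cover sums telescope down from the root. One short edge attains the minimum, which makes [c]
   complementary. *)
pose c (j : J) := mu (apex_edge j).1 (apex_edge j).2 -
  mu (kL T (inner j.1)) (kR T (inner j.1)).
have cE k : mu (kL T (inner k)) (kR T (inner k)) =
    Num.min (mu (kL T (inner k)) (inner k)) (mu (inner k) (kR T (inner k))).
  by have [_ [h _ _ _]] := inner_triangle k; apply: mu_split.
have main f : distinguished T f -> cover_sum c f.1 f.2 = mu f.1 f.2 - mu 0%N n.+1.
  elim=> [|a e b dab /= IH aeb|a e b dab /= IH aeb] /=.
  - by rewrite cover_sum_root subrr.
  - have [k [-> ka kb]] := triangle_apex dab aeb.
    by move: IH; rewrite -ka -kb cover_sum_left => ->; rewrite /c /=; lra.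
  - have [k [-> ka kb]] := triangle_apex dab aeb.
    by move: IH; rewrite -ka -kb cover_sum_right => ->; rewrite /c /=; lra.
exists c.
  split=> [[k b]|k]; rewrite /c /apex_edge /= cE.
    by case: b => /=; rewrite subr_ge0 ge_min lexx ?orbT.
  by rewrite /Num.min; case: ifP => _; [right|left]; rewrite subrr.
rewrite combination_cover; apply/proj_diagP/diag_lineP.
exists (- mu 0%N n.+1); apply/rowP => i; rewrite !mxE.
have := main (widen_ord (leqnSn n.+1) i, lift ord0 i).
rewrite /= => -> //; last by apply: (distinguished_side hT).
by rewrite /mu subSnn /= /y inord_val; lra.
Qed.
End Cover.

Lemma apex_Zspan (eps : 'I_n -> bool) (x : lattice n) :
  exists c : 'I_n -> int, x = \sum_k apex_vector (k, eps k) *~ c k.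
Proof.
pose P (x : lattice n) :=
  exists c : 'I_n -> int, x = \sum_k apex_vector (k, eps k) *~ c k.
have P0 : P 0 by exists (fun=> 0); rewrite big1 // => k _; rewrite mulr0z.
have PB u v : P u -> P v -> P (u - v).
  move=> [c ->] [d ->]; exists (fun k => c k - d k).
  by rewrite -sumrB; apply: eq_bigr => k _; rewrite mulrzBr.
have PD u v : P u -> P v -> P (u + v).
  by move=> Pu Pv; rewrite -[v]opprK; apply: (PB) => //; rewrite -sub0r; apply: PB.
have PM u m : P u -> P (u *~ m).
  move=> [c ->]; exists (fun k => c k * m).
  by rewrite mulrz_suml; apply: eq_bigr => k _; rewrite mulrzA.
have Pg k : P (apex_vector (k, eps k)).
  exists (fun i => (i == k)%:R); rewrite (bigD1 k) //= eqxx mulr1z big1 ?addr0 //.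
  by move=> i /negPf ->; rewrite mulr0z.
have PE f : distinguished T f -> P (edge_vector f).
  elim=> [|a e b dab IH aeb|a e b dab IH aeb] /=.
  - rewrite /edge_vector /=.
    (* The root edge gives the zero vector of the quotient. *)
    suff -> : varpi (ord0 : 'I_n.+2) = varpi ord_max by rewrite subrr.
    rewrite !varpiE; apply/proj_diagP/diag_lineP.
    by exists (-1); apply/rowP => k; rewrite !mxE ltn_ord sub0r.
  - have [k [-> ka kb]] := triangle_apex dab aeb.
    have := Pg k; rewrite /apex_vector /apex_edge /=; case: (eps k); rewrite ?ka ?kb //.
    (* The remaining short edge vector is the base vector minus the chosen one. *)
    move=> h; have := PB _ _ IH h.
    by rewrite /edge_vector /= opprB addrA subrK.
  - have [k [-> ka kb]] := triangle_apex dab aeb.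
    have := Pg k; rewrite /apex_vector /apex_edge /=; case: (eps k); rewrite ?ka ?kb //.
    move=> h; have := PB _ _ IH h.
    by rewrite /edge_vector /= opprB addrC addrA subrK.
have Pe i : P (proj_diag (delta_mx 0 i)).
  have /PE := distinguished_side hT (erefl : lift ord0 i = (widen_ord (leqnSn n.+1) i).+1 :> nat).
  (* The negated vector of a side is the class of a standard basis vector. *)
  move=> /(PB _ _ P0); rewrite sub0r /edge_vector opprB !varpiE -raddfB /=.
  congr (P (proj_diag _)); apply/rowP => k; rewrite !mxE /= /bump /= add1n ltnS.
  by rewrite leq_eqVlt val_eqE; case: eqVneq => [->|_] /=; rewrite ?ltnn ?subr0 ?subrr.
have [X ->] := proj_diag_surj x.
rewrite [X](row_sum_delta X) raddf_sum /=; apply: (big_ind P) => // i _.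
by rewrite linearZ /= -[X 0 i]intz scaler_int; apply: PM.
Qed.

End TriangulationVectors.

Theorem lemma6p2 (R : realType) (n : nat) (hn : (1 <= n)%N)
    (T : {set edge n}) (hT : is_triangulation T) :
  [/\ forall Q : set (lattice n), Q `<=` vw_vectors T ->
        (SigmaT R T (lcone R Q) <-> forms_cone T Q),
      is_fan (SigmaT R T),
      is_complete (SigmaT R T),
      is_nonsingular (SigmaT R T)
    & primitive_collections (SigmaT R T) =
        [set [set vvec T k; wvec T k] | k in @brack n]].
Proof.
pose U := apex_vector T.
have Zsp := apex_Zspan hT; have ex := apex_exists hT (R := R).
have un := apex_unique hT (R := R).
have vwE : vw_vectors T = range U.
  apply/seteqP; split=> [u [] [i /brackP[k ->] <-]|_ [[k []] _ <-]].
  - by exists (k, true).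
  - by exists (k, false).
  - by left; exists (inner k) => //; apply: brack_inner.
  - by right; exists (inner k) => //; apply: brack_inner.
have formsE Q : forms_cone T Q <->
    (forall k, ~ [set U (k, true); U (k, false)] `<=` Q).
  split=> [H k|H i /brackP[k ->]]; last exact: H.
  exact: (H (inner k) (brack_inner k)).
(* Once both fans agree as sets of cones, every claim is an instance of the formal half. *)
have SE : SigmaT R T = split_fan U.
  apply/seteqP; split=> [_ [Q [QU /formsE Qf] <-]|_ [A trA <-]].
    by rewrite vwE in QU; apply/split_fan_lcone.
  have AU : U @` A `<=` range U by move=> _ [j _ <-]; exists j.
  exists (U @` A) => //; split; first by rewrite vwE.
  apply/formsE; apply/(split_fan_lcone ex un AU).
  exact/(split_fanE ex un).
rewrite SE vwE; split.
- by move=> Q QU; rewrite formsE; apply: split_fan_lcone.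
- exact: split_fan_is_fan.
- exact: split_fan_complete.
- exact: split_fan_nonsingular.
- rewrite primitive_collections_split_fan //.
  apply/seteqP; split=> [_ [k _ <-]|_ [i /brackP[k ->] <-]]; last by exists k.
  by exists (inner k) => //; apply: brack_inner.
Qed.
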